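(* The Ginzburg--Landau functional with double-obstacle potential, $\mathrm{GL}_\varepsilon(u)=\frac12\|\nabla u\|_{\mathcal E}^2+\frac1\varepsilon\langle W\circ u,\mathbf 1\rangle_{\mathcal V}$, has the following $\Gamma$-limit in $\mathcal V_{[0,1]}$: $$\Gamma\text{-}\lim_{\varepsilon\downarrow0}\mathrm{GL}_\varepsilon=f_0 .$$
   Context: Let $G=(V,E)$ be a finite, undirected, simple, connected graph with symmetric weights $\omega_{ij}=\omega_{ji}$, $\omega_{ij}>0$ for $ij\in E$ and $\omega_{ij}=0$ for $ij\notin E$. Let $d_i=\sum_{j}\omega_{ij}>0$ be the degree of $i\in V$. Fix $r\in[0,1]$. Let $\mathcal V=\{u:V\to\mathbb R\}$ and, for $X\subseteq\mathbb R$, $\mathcal V_X=\{u:V\to X\}$; $\mathcal V$ carries the inner product $\langle u,v\rangle_{\mathcal V}=\sum_{i\in V}u_iv_id_i^r$, and $\mathcal V_{[0,1]}$ has the induced topology. Let $\mathcal E=\{\varphi:E\to\mathbb R\mid\varphi_{ij}=-\varphi_{ji}\}$ with $\langle\varphi,\phi\rangle_{\mathcal E}=\frac12\sum_{i,j\in V}\varphi_{ij}\phi_{ij}\omega_{ij}$ and induced norm $\|\cdot\|_{\mathcal E}$. $\mathbf 1\in\mathcal V$ is the constant function $1$. The graph gradient is $(\nabla u)_{ij}=u_j-u_i$ for $ij\in E$ (and $0$ otherwise). The double-obstacle potential is $W(x)=\frac12x(1-x)$ for $0\le x\le1$ and $W(x)=\infty$ otherwise. Graph total variation is $\mathrm{TV}(u)=\frac12\sum_{i,j\in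 V}\omega_{ij}|u_i-u_j|$. The function $f_0:\mathcal V_{[0,1]}\to[0,\infty]$ is $f_0(u)=\frac12\mathrm{TV}(u)$ if $u\in\mathcal V_{\{0,1\}}$ and $f_0(u)=\infty$ if $u\in\mathcal V_{[0,1]}\setminus\mathcal V_{\{0,1\}}$. $\Gamma$-convergence of $F_\varepsilon$ to $F$ on $\mathcal V_{[0,1]}$ as $\varepsilon\downarrow0$ means: for every sequence $\varepsilon_j\downarrow0$ and every $u\in\mathcal V_{[0,1]}$, (i) $F(u)\le\liminf_jF_{\varepsilon_j}(u_j)$ for every sequence $u_j\to u$ in $\mathcal V_{[0,1]}$, and (ii) there is a sequence $\bar u_j\to u$ in $\mathcal V_{[0,1]}$ with $F(u)=\lim_jF_{\varepsilon_j}(\bar u_j)$. *)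

(* Defs.v *)
From HB Require Import structures.
From mathcomp Require Import all_boot all_order all_algebra.
From mathcomp Require Import all_classical all_reals all_analysis.
Set Implicit Arguments.
Unset Strict Implicit.
Unset Printing Implicit Defensive.
Import Order.TTheory GRing.Theory Num.Theory.
Import numFieldNormedType.Exports.
Local Open Scope classical_set_scope.
Local Open Scope ring_scope.

Record weighted_graph (R : realType) (V : finType) := WeightedGraph {
  edge : rel V;
  edge_sym : symmetric edge;
  edge_irr : irreflexive edge;
  edge_connected : forall i j : V, connect edge i j;
  weight : V -> V -> R;
  weight_sym : forall i j : V, weight i j = weight j i;
  weight_gt0 : forall i j : V, edge i j -> 0 < weight i j;
  weight_eq0 : forall i j : V, ~~ edge i j -> weight i j = 0;
  weight_sum_gt0 : forall i : V, 0 < \sum_(j : V) weight i j }.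

Section Functionals.
Context {R : realType} {V : finType}.
Variables (G : weighted_graph R V) (r : R).

Definition degree (i : V) : R := \sum_(j : V) weight G i j.

Definition vfun_in (X : set R) : set (V -> R) :=
  [set u | forall i : V, X (u i)].

Definition innerV (u v : V -> R) : R :=
  \sum_(i : V) u i * v i * degree i `^ r.

Definition normV (u : V -> R) : R := Num.sqrt (innerV u u).

(* The topology on node functions is the one induced by [innerV]. *)
Definition cvgV (u_ : nat -> V -> R) (u : V -> R) : Prop :=
  (fun n => normV (fun i => u_ n i - u i)) @ \oo --> (0 : R).

(* [innerV] when the first argument may take the value +oo. *)
Definition einnerV (f : V -> \bar R) (v : V -> R) : \bar R :=
  (\sum_(i : V) f i * (v i * degree i `^ r)%:E)%E.

(* Edge functions are represented as functions on V * V vanishing off edges. *)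
Definition innerE (phi psi : V -> V -> R) : R :=
  2^-1 * \sum_(i : V) \sum_(j : V) phi i j * psi i j * weight G i j.

Definition normE (phi : V -> V -> R) : R := Num.sqrt (innerE phi phi).

Definition grad (u : V -> R) : V -> V -> R :=
  fun i j => if edge G i j then u j - u i else 0.

Definition TV (u : V -> R) : R :=
  2^-1 * \sum_(i : V) \sum_(j : V) weight G i j * `|u i - u j|.

Definition double_obstacle (x : R) : \bar R :=
  if (0 <= x <= 1) then (2^-1 * x * (1 - x))%:E else +oo%E.

Definition GL (eps : R) (u : V -> R) : \bar R :=
  ((2^-1 * normE (grad u) ^+ 2)%:E
   + (eps^-1)%:E * einnerV (double_obstacle \o u) (fun=> 1%R))%E.

(* Only the values on [vfun_in `[0, 1]] are meaningful. *)
Definition f0 (u : V -> R) : \bar R :=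
  if `[< vfun_in [set 0; 1] u >] then (2^-1 * TV u)%:E else +oo%E.

(* Gamma-convergence, as eps decreases to 0, of F eps to F0 on the subspace A
   of node functions; values outside A and at eps <= 0 play no role. *)
Definition Gamma_cvg (A : set (V -> R)) (F : R -> (V -> R) -> \bar R)
    (F0 : (V -> R) -> \bar R) : Prop :=
  forall eps : nat -> R,
    (forall n, 0 < eps n) -> eps @ \oo --> (0 : R) ->
  forall u : V -> R, A u ->
    (forall u_ : nat -> V -> R, (forall n, A (u_ n)) -> cvgV u_ u ->
       (F0 u <= limn_einf (fun n => F (eps n) (u_ n)))%E)
    /\
    (exists u_ : nat -> V -> R,
       [/\ forall n, A (u_ n), cvgV u_ u &
           (fun n => F (eps n) (u_ n)) @ \oo --> F0 u]).

End Functionals.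

(* Main.v *)
Require Import Defs.
From mathcomp Require Import all_boot all_order all_algebra.
From mathcomp Require Import all_classical all_reals all_analysis.
Import Order.TTheory GRing.Theory Num.Theory.
Import numFieldNormedType.Exports.
Local Open Scope classical_set_scope.
Local Open Scope ring_scope.

(** On functions with values in [0, 1] the functional is real-valued: it is
    D(u) + w(u) / eps, with D the Dirichlet energy and w >= 0 the total energy
    of the double-obstacle wells ([GL_obstacleE]). Both D and w are polynomials
    in finitely many node values, and convergence for the weighted inner product
    is nodewise convergence because every degree is positive ([cvgV_node]); so D
    and w are continuous. The obstacle keeps the node values in [0, 1], where w
    vanishes exactly on the functions with values in {0, 1}.

    If u is {0, 1}-valued, each difference of node values is 0 or +-1 and hence
    has square equal to absolute value, so D(u) = TV(u) / 2
    ([dirichlet_binary]). The lower bound follows from continuity of D and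
    D <= GL_eps, and the constant sequence u is a recovery sequence because
    w(u) = 0. If u takes a value strictly between 0 and 1, then w(u) > 0, w
    eventually stays above w(u) / 2 along any sequence converging to u, and
    GL_eps tends to +oo at least as fast as a multiple of 1 / eps ([GL_cvgy]);
    this gives the lower bound, and again the constant sequence is a recovery
    sequence. *)

Lemma le_limn_einf (R : realType) (f g : (\bar R)^nat) :
  (forall n, (f n <= g n)%E) -> (limn_einf f <= limn_einf g)%E.
Proof.
move=> fg; rewrite !limn_einf_lim; apply: lee_lim.
- exact: is_cvg_einfs.
- exact: is_cvg_einfs.
- apply: nearW => n; apply: le_ereal_inf_tmp => _ /= [k nk <-].
  by apply: le_trans (fg k); apply: ereal_inf_lbound; exists k.
Qed.

Lemma cvgr_sum (R : realType) (V : finType) (f : V -> nat -> R) (l : V -> R) :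
  (forall i, f i @ \oo --> l i) ->
  (fun n => \sum_(i : V) f i n) @ \oo --> \sum_(i : V) l i.
Proof. by move=> fl; apply: cvg_big => // -[x y]; exact: add_continuous. Qed.

Section DoubleObstacleEnergy.
Set Implicit Arguments.
Unset Strict Implicit.
Variables (R : realType) (V : finType) (G : weighted_graph R V) (r : R).
Implicit Types u : V -> R.

Lemma degree_powR_gt0 (i : V) : 0 < degree G i `^ r.
Proof. by rewrite powR_gt0 // /degree weight_sum_gt0. Qed.

Lemma weight_ge0 (i j : V) : 0 <= weight G i j.
Proof.
have [/(weight_gt0 (w := G))/ltW//|] := boolP (edge G i j).
by move/(weight_eq0 (w := G)) => ->.
Qed.

(** The norm dominates each node value up to the factor d_i^(r/2), which is
    positive. *)
Lemma node_le_normV (u : V -> R) (i : V) :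
  `|u i| * Num.sqrt (degree G i `^ r) <= normV G r u.
Proof.
rewrite /normV -sqrtr_sqr -sqrtrM ?sqr_ge0//; apply: ler_wsqrtr.
rewrite /innerV (bigD1 i) //= expr2 lerDl sumr_ge0 // => j _.
by rewrite mulr_ge0 ?powR_ge0 // -expr2 sqr_ge0.
Qed.

Lemma cvgV_node (u_ : nat -> V -> R) (u : V -> R) (i : V) :
  Defs.cvgV G r u_ u -> (fun n => u_ n i) @ \oo --> u i.
Proof.
move=> cu; set c := Num.sqrt (degree G i `^ r).
have c0 : 0 < c by rewrite sqrtr_gt0 degree_powR_gt0.
apply/subr_cvg0; apply: (@norm_cvg0 _ R).
have bound n : 0 <= `|u_ n i - u i| <= normV G r (fun j => u_ n j - u j) / c.
  by rewrite normr_ge0 ler_pdivlMr // (node_le_normV (fun j => _)).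
have normV_c0 :
    (fun n => normV G r (fun j => u_ n j - u j) / c) @ \oo --> (0 : R).
  by rewrite -[X in _ --> X](mul0r c^-1); exact: cvgMl.
apply: squeeze_cvgr normV_c0; [exact: nearW bound|exact: cvg_cst].
Qed.

(** One factor 1/2 comes from the functional, the other from the inner product
    on edge functions, whose double sum counts each edge twice. *)
Definition dirichlet (u : V -> R) : R :=
  4^-1 * \sum_(i : V) \sum_(j : V) weight G i j * (u j - u i) ^+ 2.

Lemma dirichlet_ge0 u : 0 <= dirichlet u.
Proof.
rewrite mulr_ge0 // sumr_ge0 // => i _; rewrite sumr_ge0 // => j _.
by rewrite mulr_ge0 ?weight_ge0 ?sqr_ge0.
Qed.

Definition well_energy (u : V -> R) : R :=
  \sum_(i : V) 2^-1 * u i * (1 - u i) * degree G i `^ r.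

Lemma half_normE_grad (u : V -> R) :
  2^-1 * normE G (grad G u) ^+ 2 = dirichlet u.
Proof.
rewrite /normE sqr_sqrtr /innerE; last first.
  rewrite mulr_ge0 // sumr_ge0 // => i _; rewrite sumr_ge0 // => j _.
  by rewrite mulr_ge0 ?weight_ge0 // -expr2 sqr_ge0.
rewrite mulrA -invfM -natrM /dirichlet; congr (_ * _).
apply: eq_bigr => i _; apply: eq_bigr => j _; rewrite /grad.
have [ij|/(weight_eq0 (w := G)) ->] := boolP (edge G i j).
  by rewrite -expr2 mulrC.
by rewrite mulr0 mul0r.
Qed.

Lemma well_term_ge0 u (i : V) : vfun_in `[0, 1] u ->
  0 <= 2^-1 * u i * (1 - u i) * degree G i `^ r.
Proof.
move=> u01; have /= := u01 i; rewrite in_itv /= => /andP[u0 u1].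
by rewrite !mulr_ge0 ?powR_ge0 ?subr_ge0.
Qed.

Lemma well_energy_ge0 u : vfun_in `[0, 1] u -> 0 <= well_energy u.
Proof. by move=> u01; apply: sumr_ge0 => i _; exact: well_term_ge0. Qed.

(** Some node value lies strictly between 0 and 1; its well term is positive
    because the factor d_i^r is. *)
Lemma well_energy_gt0 u : vfun_in `[0, 1] u -> ~ vfun_in [set 0; 1] u ->
  0 < well_energy u.
Proof.
move=> u01 /existsNP[i uiN].
rewrite /well_energy (bigD1 i) //= ltr_pwDl //; last first.
  by apply: sumr_ge0 => j _; exact: well_term_ge0.
have /= := u01 i; rewrite in_itv /= => /andP[u0 u1].
rewrite mulr_gt0 ?degree_powR_gt0 // mulr_gt0 ?subr_gt0 //.
  rewrite mulr_gt0 // lt_neqAle u0 andbT eq_sym.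
  by apply/eqP => ui0; apply: uiN; left.
by rewrite lt_neqAle u1 andbT; apply/eqP => ui1; apply: uiN; right.
Qed.

Lemma well_energy_binary u : vfun_in [set 0; 1] u -> well_energy u = 0.
Proof.
move=> ub; apply: big1 => i _.
by case: (ub i) => ->; rewrite ?subrr !(mulr0, mul0r).
Qed.

(** Differences of {0, 1}-values are 0, 1 or -1, for which the square and the
    absolute value agree. *)
Lemma dirichlet_binary u : vfun_in [set 0; 1] u -> dirichlet u = 2^-1 * TV G u.
Proof.
move=> ub; rewrite /dirichlet /TV mulrA -invfM -natrM; congr (_ * _).
apply: eq_bigr => i _; apply: eq_bigr => j _; congr (_ * _).
by case: (ub i) => ->; case: (ub j) => ->;
  rewrite ?subrr ?subr0 ?sub0r ?sqrrN ?normrN ?expr1n ?normr1 ?normr0 ?expr0n.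
Qed.

Lemma GL_obstacleE (eps : R) u : vfun_in `[0, 1] u ->
  GL G r eps u = (dirichlet u + eps^-1 * well_energy u)%:E.
Proof.
move=> u01; rewrite /GL half_normE_grad EFinD (EFinM eps^-1).
congr (_ + _ * _)%E.
rewrite /einnerV /well_energy -sumEFin; apply: eq_bigr => i _.
have /= := u01 i; rewrite in_itv /= /double_obstacle /= => ->.
by rewrite mul1r -EFinM.
Qed.

Section Continuity.
Variables (u_ : nat -> V -> R) (u : V -> R).
Hypothesis cu : Defs.cvgV G r u_ u.

Lemma dirichlet_cvg : (fun n => dirichlet (u_ n)) @ \oo --> dirichlet u.
Proof.
apply: cvgMr; apply: cvgr_sum => i; apply: cvgr_sum => j; apply: cvgMr.
by rewrite expr2; apply: cvgM; apply: cvgB; exact: cvgV_node cu.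
Qed.

Lemma well_energy_cvg : (fun n => well_energy (u_ n)) @ \oo --> well_energy u.
Proof.
apply: cvgr_sum => i; apply: cvgMl; apply: cvgM.
  by apply: cvgMr; exact: cvgV_node cu.
by apply: cvgB; [exact: cvg_cst|exact: cvgV_node cu].
Qed.

(** The well energy along the sequence is eventually at least half of its
    positive limit, so the prefactor 1 / eps drives the functional to +oo. *)
Lemma GL_cvgy (eps : nat -> R) :
  (forall n, 0 < eps n) -> eps @ \oo --> (0 : R) ->
  (forall n, vfun_in `[0, 1] (u_ n)) ->
  vfun_in `[0, 1] u -> ~ vfun_in [set 0; 1] u ->
  (fun n => GL G r (eps n) (u_ n)) @ \oo --> +oo%E.
Proof.
move=> eps0 epsc un01 u01 uN.
have w0 := well_energy_gt0 u01 uN.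
under eq_cvg do rewrite GL_obstacleE //.
apply/cvgeryP.
have w20 : 0 < well_energy u / 2 by rewrite divr_gt0.
have half : \forall n \near \oo, well_energy u / 2 < well_energy (u_ n).
  apply: (cvgr_gt _ well_energy_cvg).
  by rewrite ltr_pdivrMr // ltr_pMr // ltr1n.
have epsy : (fun n => (eps n)^-1) @ \oo --> +oo.
  by apply/cvgrVy => //; apply: nearW.
apply/cvgryPge => A.
have large := cvgry_ge epsy (A / (well_energy u / 2)).
near=> n.
have hn : well_energy u / 2 <= well_energy (u_ n).
  by apply/ltW; near: n; exact: half.
have : A / (well_energy u / 2) <= (eps n)^-1 by near: n; exact: large.
rewrite ler_pdivrMr // => /le_trans -> //.
rewrite -[leLHS]add0r lerD //; last by rewrite ler_pM2l // invr_gt0.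
exact: dirichlet_ge0.
Unshelve. all: by end_near. Qed.

End Continuity.
End DoubleObstacleEnergy.

Theorem theorem6p1 (R : realType) (V : finType) (G : weighted_graph R V)
    (r : R) (r01 : 0 <= r <= 1) :
  Gamma_cvg G r (vfun_in `[0, 1]) (GL G r) (f0 G).
Proof.
move=> eps eps0 epsc u u01.
have cst_cvg : Defs.cvgV G r (fun=> u) u.
  rewrite /Defs.cvgV (_ : (fun _ => _) = cst 0); first exact: cvg_cst.
  apply/funext => n; rewrite /normV /innerV big1 ?sqrtr0 // => i _.
  by rewrite subrr mul0r mul0r.
rewrite /f0; case: asboolP => ub; split.
- move=> u_ un01 cu.
  rewrite -dirichlet_binary //.
  have cD : (fun n => (dirichlet G (u_ n))%:E) @ \oo --> (dirichlet G u)%:E.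
    by apply/fine_cvgP; split; [exact: filterE|exact: dirichlet_cvg cu].
  rewrite -(cvg_limn_einf_sup cD).1; apply: le_limn_einf => n.
  rewrite GL_obstacleE // lee_fin lerDl mulr_ge0 ?invr_ge0 ?(ltW (eps0 n)) //.
  exact: well_energy_ge0.
- exists (fun=> u); split => //.
  rewrite [X in X @ _](_ : _ = cst (2^-1 * TV G u)%:E).
    by apply: cvg_cst.
  apply/funext => n.
  by rewrite GL_obstacleE // well_energy_binary // mulr0 addr0 dirichlet_binary.
- move=> u_ un01 cu.
  by rewrite (cvg_limn_einf_sup (GL_cvgy cu eps0 epsc un01 u01 ub)).1.
- exists (fun=> u); split => //.
  exact: (GL_cvgy cst_cvg eps0 epsc (fun=> u01) u01 ub).
Qed.
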